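(* Let $G$ be a group. In the braided strict monoidal category $\mathbf{TRel}_G$, the object $G=G^1$ is a commutative Frobenius algebra with the following structure: $\nabla:G\otimes G\to G$ is the multiplication function of the group $G$ regarded as a relation, $(x,y)\sim xy$; $n:I\to G$ is the identity of the group regarded as a relation, $*\sim 1$; $\Delta:G\to G\otimes G$ is the opposite relation of $\nabla$; and $e:G\to I$ is the opposite relation of $n$.
   Context: Definition of $\mathbf{TRel}_G$: the objects are the formal powers $G^n$ ($n\ge 0$) of $G$. The arrows from $G^m$ to $G^n$ are the relations $R$ from the set $G^m$ to the set $G^n$ satisfying: 1) if $(x_1,\dots,x_m)R(y_1,\dots,y_n)$ then for all $g\in G$ also $(g^{-1}x_1g,\dots,g^{-1}x_mg)R(g^{-1}y_1g,\dots,g^{-1}y_ng)$; 2) if $(x_1,\dots,x_m)R(y_1,\dots,y_n)$ then $x_1\cdots x_m(y_1\cdots y_n)^{-1}\in Z(G)$, the center of $G$. Composition and identities are those of relations. $\mathbf{TRel}_G$ is braided strict monoidal with $G^m\otimes G^n=G^{m+n}$, unit $I=G^0$ (the one-point set $\{*\}$), tensor of arrows the product of relations, and twist $\tau_{m,n}:G^m\otimes G^n\to G^n\otimes G^m$ the functional relation $(x,y)\sim(\overline{x}\,y\,\overline{x}^{-1},x)$, where $\overline{x}=x_1\cdots x_m$ and conjugation of the tuple $y$ is componentwise. Commutative Frobenius algebra in a braided strict monoidal category with twist $\tau$ (composition written right to left): an object $G$ with arrows $\nabla:G\otimes G\to G$, $\Delta:G\to G\otimes G$, $n:I\to G$, $e:G\to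 I$ such that $(G,\nabla,n)$ is a monoid, $(G,\Delta,e)$ is a comonoid, $(1_G\otimes\nabla)(\Delta\otimes 1_G)=\Delta\nabla=(\nabla\otimes 1_G)(1_G\otimes\Delta)$, $\nabla\tau_{G,G}=\nabla$ and $\tau_{G,G}\Delta=\Delta$. *)

(* Defs.v *)
From HB Require Import structures.
From mathcomp Require Import all_boot.
From mathcomp Require Import boolp classical_sets.

Set Implicit Arguments.
Unset Strict Implicit.
Unset Printing Implicit Defensive.

Declare Scope cat_scope.
Delimit Scope cat_scope with cat.

Record category := Category {
  ob : Type;
  hom : ob -> ob -> Type;
  idm : forall a, hom a a;
  compm : forall a b c, hom b c -> hom a b -> hom a c;
  comp1m : forall a b (f : hom a b), compm (idm b) f = f;
  compm1 : forall a b (f : hom a b), compm f (idm a) = f;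
  compmA : forall a b c d (h : hom c d) (g : hom b c) (f : hom a b),
    compm h (compm g f) = compm (compm h g) f
}.

Arguments hom {_} _ _.
Arguments idm {_} a.
Arguments compm {_ a b _} _ _.

Notation "g \oc f" := (compm g f)
  (at level 40, left associativity, format "g  \oc  f") : cat_scope.
Notation "\id_ a" := (idm a) (at level 8, a at level 2, format "\id_ a") : cat_scope.
Local Open Scope cat_scope.

(* In a strict monoidal category (a (x) b) (x) c and a (x) (b (x) c) are equal
   objects, but in general not convertible ones: [eqm p] is the identity arrow
   of [a], with its codomain rewritten along [p : a = b]. *)
Definition eqm (C : category) (a b : ob C) (p : a = b) : hom a b :=
  ecast x (hom a x) p \id_a.

(* The last three fields say that f (x) (g (x) h) = (f (x) g) (x) h,
   1_I (x) f = f and f (x) 1_I = f, up to the identifications [eqm]. *)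
Record strictMonoidal := StrictMonoidal {
  smcat :> category;
  unito : ob smcat;
  tenso : ob smcat -> ob smcat -> ob smcat;
  tensm : forall a a' b b' : ob smcat,
    hom a a' -> hom b b' -> hom (tenso a b) (tenso a' b');
  tensoA : forall a b c, tenso (tenso a b) c = tenso a (tenso b c);
  tens1o : forall a, tenso unito a = a;
  tenso1 : forall a, tenso a unito = a;
  tensm_id : forall a b, tensm \id_a \id_b = \id_(tenso a b);
  tensm_comp : forall (a a' a'' b b' b'' : ob smcat)
      (f' : hom a' a'') (f : hom a a') (g' : hom b' b'') (g : hom b b'),
    tensm (f' \oc f) (g' \oc g) = tensm f' g' \oc tensm f g;
  tensmA : forall (a a' b b' c c' : ob smcat)
      (f : hom a a') (g : hom b b') (h : hom c c'),
    eqm (tensoA a' b' c') \oc tensm (tensm f g) h =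
    tensm f (tensm g h) \oc eqm (tensoA a b c);
  tens1m : forall (a a' : ob smcat) (f : hom a a'),
    eqm (tens1o a') \oc tensm \id_unito f = f \oc eqm (tens1o a);
  tensm1 : forall (a a' : ob smcat) (f : hom a a'),
    eqm (tenso1 a') \oc tensm f \id_unito = f \oc eqm (tenso1 a)
}.

Arguments unito {_}.
Arguments tenso {_} _ _.
Arguments tensm {_ a a' b b'} _ _.
Arguments tensoA {_} a b c.
Arguments tens1o {_} a.
Arguments tenso1 {_} a.

Notation "a \ox b" := (tenso a b)
  (at level 38, left associativity, format "a  \ox  b") : cat_scope.
Notation "f \om g" := (tensm f g)
  (at level 38, left associativity, format "f  \om  g") : cat_scope.

(* The last two fields are the hexagon identities
   tau_(a (x) b, c) = (tau_(a, c) (x) 1_b) (1_a (x) tau_(b, c)) and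
   tau_(a, b (x) c) = (1_b (x) tau_(a, c)) (tau_(a, b) (x) 1_c). *)
Record braided := Braided {
  brcat :> strictMonoidal;
  twist : forall a b : ob brcat, hom (a \ox b) (b \ox a);
  twist_inv : forall a b, exists s : hom (b \ox a) (a \ox b),
    s \oc twist a b = \id_(a \ox b) /\ twist a b \oc s = \id_(b \ox a);
  twist_nat : forall (a a' b b' : ob brcat) (f : hom a a') (g : hom b b'),
    twist a' b' \oc (f \om g) = (g \om f) \oc twist a b;
  twist_tensl : forall a b c : ob brcat,
    twist (a \ox b) c =
    eqm (tensoA c a b) \oc (twist a c \om \id_b)
      \oc eqm (esym (tensoA a c b)) \oc (\id_a \om twist b c)
      \oc eqm (tensoA a b c);
  twist_tensr : forall a b c : ob brcat,
    twist a (b \ox c) =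
    eqm (esym (tensoA b c a)) \oc (\id_b \om twist a c)
      \oc eqm (tensoA b a c) \oc (twist a b \om \id_c)
      \oc eqm (esym (tensoA a b c))
}.

Arguments twist {_} _ _.

Definition is_monoid (C : strictMonoidal) (A : ob C)
    (nabla : hom (A \ox A) A) (n : hom unito A) : Prop :=
  [/\ nabla \oc (nabla \om \id_A) =
        nabla \oc (\id_A \om nabla) \oc eqm (tensoA A A A),
      nabla \oc (n \om \id_A) = eqm (tens1o A) &
      nabla \oc (\id_A \om n) = eqm (tenso1 A)].

Definition is_comonoid (C : strictMonoidal) (A : ob C)
    (Delta : hom A (A \ox A)) (e : hom A unito) : Prop :=
  [/\ eqm (tensoA A A A) \oc (Delta \om \id_A) \oc Delta =
        (\id_A \om Delta) \oc Delta,
      eqm (tens1o A) \oc (e \om \id_A) \oc Delta = \id_A &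
      eqm (tenso1 A) \oc (\id_A \om e) \oc Delta = \id_A].

Record is_commutative_frobenius (C : braided) (A : ob C)
    (nabla : hom (A \ox A) A) (Delta : hom A (A \ox A))
    (n : hom unito A) (e : hom A unito) : Prop := IsCommutativeFrobenius {
  frob_monoid : is_monoid nabla n;
  frob_comonoid : is_comonoid Delta e;
  frob_left : (\id_A \om nabla) \oc eqm (tensoA A A A) \oc (Delta \om \id_A)
    = Delta \oc nabla;
  frob_right : Delta \oc nabla =
    (nabla \om \id_A) \oc eqm (esym (tensoA A A A)) \oc (\id_A \om Delta);
  frob_comm : nabla \oc twist A A = nabla;
  frob_cocomm : twist A A \oc Delta = Delta
}.

Section TRel.
Variable G : groupType.
Implicit Types m n p q : nat.

Local Open Scope classical_set_scope.
Local Open Scope group_scope.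

Definition center : set G := [set z | forall g, commute z g].

Definition tprod m (x : m.-tuple G) : G := \prod_(g <- x) g.

(* In the library x ^ g stands for g^-1 * (x * g). *)
Definition tconj m (x : m.-tuple G) (g : G) : m.-tuple G :=
  map_tuple (fun h => h ^ g) x.

Record trel m n := TRelArrow {
  trel_set :> m.-tuple G * n.-tuple G -> Prop;
  trel_conj : forall x y, trel_set (x, y) ->
    forall g, trel_set (tconj x g, tconj y g);
  trel_center : forall x y, trel_set (x, y) -> center (tprod x / tprod y)
}.

Lemma trelP m n (R S : trel m n) :
  (forall x y, R (x, y) <-> S (x, y)) -> R = S.
Proof.
case: R S => [R R1 R2] [S S1 S2] /= RS.
have E : R = S by apply/predeqP => -[x y]; exact: RS.
by subst S; congr TRelArrow; apply: Prop_irrelevance.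
Qed.

Lemma center1 : center 1.
Proof. by move=> g; apply/commute_sym/commute1. Qed.

Lemma centerM z w : center z -> center w -> center (z * w).
Proof. by move=> cz cw g; apply/commute_sym/commuteM; apply/commute_sym. Qed.

Lemma tprod_conj m (x : m.-tuple G) g : tprod (tconj x g) = tprod x ^ g.
Proof. by rewrite /tprod /= big_map conjg_prod. Qed.

Lemma tprod_cat m n (x : m.-tuple G) (y : n.-tuple G) :
  tprod (cat_tuple x y) = tprod x * tprod y.
Proof. by rewrite /tprod /= big_cat. Qed.

Lemma tconj_cat m n (x : m.-tuple G) (y : n.-tuple G) g :
  tconj (cat_tuple x y) g = cat_tuple (tconj x g) (tconj y g).
Proof. by apply: val_inj; rewrite /= map_cat. Qed.

Lemma tconjM m (x : m.-tuple G) g h : tconj (tconj x g) h = tconj x (g * h).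
Proof.
by apply: val_inj; rewrite /= -map_comp; apply: eq_map => k /=; rewrite conjgM.
Qed.

Lemma tconj1 m (x : m.-tuple G) : tconj x 1 = x.
Proof.
by apply: val_inj; rewrite /= -[RHS]map_id; apply: eq_map => k /=; rewrite conjg1.
Qed.

Lemma tconjC m (x : m.-tuple G) z g : center z -> tconj x (z * g) = tconj x g.
Proof.
move=> cz; rewrite -tconjM; congr tconj; apply: val_inj => /=.
rewrite -[RHS]map_id; apply: eq_map => k /=.
by rewrite conjgE -cz mulKg.
Qed.

Lemma cat_tuple_inj m n (x x' : m.-tuple G) (y y' : n.-tuple G) :
  cat_tuple x y = cat_tuple x' y' -> x = x' /\ y = y'.
Proof.
move=> /(congr1 val) /= /eqP; rewrite eqseq_cat ?size_tuple //.
by case/andP=> /eqP/val_inj -> /eqP/val_inj ->.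
Qed.

Lemma cat_tuple_split m n (x : (m + n).-tuple G) :
  exists (u : m.-tuple G) (v : n.-tuple G), x = cat_tuple u v.
Proof.
have su : size (take m x) == m by rewrite size_takel // size_tuple leq_addr.
have sv : size (drop m x) == n by rewrite size_drop size_tuple addKn.
by exists (Tuple su), (Tuple sv); apply: val_inj; rewrite /= cat_take_drop.
Qed.

Lemma trel_id_subproof1 m (x y : m.-tuple G) :
  diagonal (x, y) -> forall g, diagonal (tconj x g, tconj y g).
Proof. by move=> D g; rewrite (D : x = y). Qed.

Lemma trel_id_subproof2 m (x y : m.-tuple G) :
  diagonal (x, y) -> center (tprod x / tprod y).
Proof. by move=> D; rewrite (D : x = y) mulgV; exact: center1. Qed.

Definition trel_id m : trel m m :=
  TRelArrow (@trel_id_subproof1 m) (@trel_id_subproof2 m).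

Section Comp.
Variables (m n p : nat) (S : trel n p) (R : trel m n).

(* Beware: for relations, S \; R is R followed by S. *)
Let SR : set (m.-tuple G * p.-tuple G) := (S \; R)%relation.

Lemma trel_comp_subproof1 x y :
  SR (x, y) -> forall g, SR (tconj x g, tconj y g).
Proof.
by case=> z Rxz Szy g; exists (tconj z g) => /=; apply: trel_conj.
Qed.

Lemma trel_comp_subproof2 x y : SR (x, y) -> center (tprod x / tprod y).
Proof.
case=> z /trel_center Rxz /trel_center Szy.
by move: (centerM Rxz Szy); rewrite /= mulgA mulgVK.
Qed.

Definition trel_comp : trel m p :=
  TRelArrow trel_comp_subproof1 trel_comp_subproof2.
End Comp.

Section Tensor.
Variables (m m' n n' : nat) (R : trel m m') (S : trel n n').

Let RS : set ((m + n).-tuple G * (m' + n').-tuple G) :=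
  [set r | exists x x' y y',
    [/\ r = (cat_tuple x y, cat_tuple x' y'), R (x, x') & S (y, y')]].

Lemma trel_tens_subproof1 x y :
  RS (x, y) -> forall g, RS (tconj x g, tconj y g).
Proof.
case=> u [u' [v [v' [[-> ->] Ru Sv]]]] g.
exists (tconj u g), (tconj u' g), (tconj v g), (tconj v' g).
by rewrite !tconj_cat; split=> //; apply: trel_conj.
Qed.

Lemma trel_tens_subproof2 x y : RS (x, y) -> center (tprod x / tprod y).
Proof.
case=> u [u' [v [v' [[-> ->] /trel_center Ru /trel_center Sv]]]].
move: (centerM Ru Sv); rewrite !tprod_cat; congr (center _).
by rewrite invgM -!mulgA; congr (_ * _); rewrite -Sv !mulgA.
Qed.

Definition trel_tens : trel (m + n) (m' + n') :=
  TRelArrow trel_tens_subproof1 trel_tens_subproof2.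
End Tensor.

Section Twist.
Variables m n : nat.

Let T : set ((m + n).-tuple G * (n + m).-tuple G) :=
  [set r | exists x y,
    r = (cat_tuple x y, cat_tuple (tconj y (tprod x)^-1) x)].

Lemma trel_twist_subproof1 x y :
  T (x, y) -> forall g, T (tconj x g, tconj y g).
Proof.
case=> u [v [-> ->]] g; exists (tconj u g), (tconj v g).
rewrite !tconj_cat !tconjM tprod_conj -conjVg conjgE.
by congr (_, cat_tuple (tconj _ _) _); rewrite !mulgA mulgV mul1g.
Qed.

Lemma trel_twist_subproof2 x y : T (x, y) -> center (tprod x / tprod y).
Proof.
case=> u [v [-> ->]]; rewrite !tprod_cat tprod_conj conjgE invgK.
by rewrite mulgA mulgVK mulgV; exact: center1.
Qed.

Definition trel_twist : trel (m + n) (n + m) :=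
  TRelArrow trel_twist_subproof1 trel_twist_subproof2.
End Twist.

Lemma trel_idE m (x y : m.-tuple G) : trel_id m (x, y) <-> x = y.
Proof. by []. Qed.

Lemma trel_compE m n p (S : trel n p) (R : trel m n) x y :
  trel_comp S R (x, y) <-> exists2 z, R (x, z) & S (z, y).
Proof. by []. Qed.

Lemma trel_comp1m m n (R : trel m n) : trel_comp (trel_id n) R = R.
Proof.
apply: trelP => x y; split=> [[z /= Rxz E]|Rxy].
  by rewrite -(E : z = y).
by exists y.
Qed.

Lemma trel_compm1 m n (R : trel m n) : trel_comp R (trel_id m) = R.
Proof.
apply: trelP => x y; split=> [[z /= E Rzy]|Rxy].
  by rewrite (E : x = z).
by exists x.
Qed.

Lemma trel_compA m n p q (T : trel p q) (S : trel n p) (R : trel m n) :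
  trel_comp T (trel_comp S R) = trel_comp (trel_comp T S) R.
Proof.
apply: trelP => x y; split=> [[z [/= w Rxw Swz] Tzy]|[w Rxw [/= z Swz Tzy]]].
  by exists w => //; exists z.
by exists z => //; exists w.
Qed.

(* The objects are the formal powers of G, represented by their exponents. *)
Definition TRel_cat : category :=
  Category trel_comp1m trel_compm1 trel_compA.

Definition teqm m n (E : m = n) : trel m n := @eqm TRel_cat m n E.

Lemma trel_eqmE m n (E : m = n) (x : m.-tuple G) (y : n.-tuple G) :
  teqm E (x, y) <-> val x = val y.
Proof. by case: _ / E y => y; split=> [D|/val_inj->//]; rewrite (D : x = y). Qed.

Lemma trel_tensE m m' n n' (R : trel m m') (S : trel n n') x x' y y' :
  trel_tens R S (cat_tuple x y, cat_tuple x' y') <-> R (x, x') /\ S (y, y').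
Proof.
split=> [[u [u' [v [v' [[]]]]]]|[Rx Sy]]; last by exists x, x', y, y'.
move=> E E'; have [-> ->] : x = u /\ y = v by apply/cat_tuple_inj/val_inj.
by have [-> ->] : x' = u' /\ y' = v' by apply/cat_tuple_inj/val_inj.
Qed.

Lemma trel_tens_id m n :
  trel_tens (trel_id m) (trel_id n) = trel_id (m + n).
Proof.
apply: trelP => x y; split=> [[u [u' [v [v' [[-> ->] D D']]]]]|D].
  by rewrite (D : u = u') (D' : v = v').
rewrite -(D : x = y).
by have [u [v ->]] := cat_tuple_split x; exists u, u, v, v.
Qed.

Lemma trel_tens_comp m m' m'' n n' n'' (R' : trel m' m'') (R : trel m m')
    (S' : trel n' n'') (S : trel n n') :
  trel_tens (trel_comp R' R) (trel_comp S' S) =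
  trel_comp (trel_tens R' S') (trel_tens R S).
Proof.
apply: trelP => x y.
have [u [v ->]] := cat_tuple_split x; have [u' [v' ->]] := cat_tuple_split y.
rewrite trel_tensE !trel_compE; split=> [[[w Ru R'w] [z Sv S'z]]|[z]].
  by exists (cat_tuple w z); apply/trel_tensE.
have [w [w' ->]] := cat_tuple_split z.
move=> /trel_tensE[Ru Sv] /trel_tensE[R'w S'w].
by split; [exists w|exists w'].
Qed.

Lemma trel_eqm_nat m n m' n' (E : m = n) (E' : m' = n')
    (R : trel m m') (S : trel n n') :
  (forall x y, R (x, y) <-> S (tcast E x, tcast E' y)) ->
  trel_comp (teqm E') R = trel_comp S (teqm E).
Proof.
case: _ / E S; case: _ / E' => S RS.
by rewrite /teqm /eqm /= trel_comp1m trel_compm1; apply: trelP.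
Qed.

Lemma tcast_catA m n p (E : m + n + p = m + (n + p)) (x : m.-tuple G)
    (y : n.-tuple G) (z : p.-tuple G) :
  tcast E (cat_tuple (cat_tuple x y) z) = cat_tuple x (cat_tuple y z).
Proof. by apply: val_inj; rewrite /= val_tcast /= catA. Qed.

Lemma tcast_catAV m n p (E : m + (n + p) = m + n + p) (x : m.-tuple G)
    (y : n.-tuple G) (z : p.-tuple G) :
  tcast E (cat_tuple x (cat_tuple y z)) = cat_tuple (cat_tuple x y) z.
Proof. by apply: val_inj; rewrite /= val_tcast /= catA. Qed.

Lemma trel_tensA m m' n n' p p' (R : trel m m') (S : trel n n')
    (T : trel p p') :
  trel_comp (teqm (esym (addnA m' n' p'))) (trel_tens (trel_tens R S) T) =
  trel_comp (trel_tens R (trel_tens S T)) (teqm (esym (addnA m n p))).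
Proof.
apply: trel_eqm_nat => x y.
have [xy [z ->]] := cat_tuple_split x; have [u [v ->]] := cat_tuple_split xy.
have [xy' [z' ->]] := cat_tuple_split y; have [u' [v' ->]] := cat_tuple_split xy'.
rewrite !tcast_catA; split=> [/trel_tensE[/trel_tensE[? ?] ?]|].
  by apply/trel_tensE; split=> //; apply/trel_tensE.
move=> /trel_tensE[? /trel_tensE[? ?]].
by apply/trel_tensE; split=> //; apply/trel_tensE.
Qed.

Lemma trel_tens1m m m' (R : trel m m') :
  trel_comp (teqm (add0n m')) (trel_tens (trel_id 0) R) =
  trel_comp R (teqm (add0n m)).
Proof.
apply: trel_eqm_nat => x y.
have [a [u ->]] := cat_tuple_split x; have [b [v ->]] := cat_tuple_split y.
have c0 k (E : 0 + k = k) (a' : 0.-tuple G) (c : k.-tuple G) :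
    tcast E (cat_tuple a' c) = c.
  by apply: val_inj; rewrite /= val_tcast /= (tuple0 a').
rewrite !c0; split=> [/trel_tensE[]//|Ruv].
by apply/trel_tensE; split=> //=; rewrite (tuple0 a) (tuple0 b).
Qed.

Lemma trel_tensm1 m m' (R : trel m m') :
  trel_comp (teqm (addn0 m')) (trel_tens R (trel_id 0)) =
  trel_comp R (teqm (addn0 m)).
Proof.
apply: trel_eqm_nat => x y.
have [u [a ->]] := cat_tuple_split x; have [v [b ->]] := cat_tuple_split y.
have c0 k (E : k + 0 = k) (c : k.-tuple G) (a' : 0.-tuple G) :
    tcast E (cat_tuple c a') = c.
  by apply: val_inj; rewrite /= val_tcast /= (tuple0 a') cats0.
rewrite !c0; split=> [/trel_tensE[]//|Ruv].
by apply/trel_tensE; split=> //=; rewrite (tuple0 a) (tuple0 b).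
Qed.

Definition TRel_monoidal : strictMonoidal :=
  @StrictMonoidal TRel_cat 0 addn trel_tens
    (fun m n p => esym (addnA m n p)) add0n addn0
    trel_tens_id trel_tens_comp trel_tensA trel_tens1m trel_tensm1.

Lemma trel_twistE m n (x : m.-tuple G) (y : n.-tuple G) z :
  trel_twist m n (cat_tuple x y, z) <->
  z = cat_tuple (tconj y (tprod x)^-1) x.
Proof.
split=> [[u [v [E ->]]]|->]; last by exists x, y.
by have [-> ->] : x = u /\ y = v by apply/cat_tuple_inj/val_inj.
Qed.

Section TwistInv.
Variables m n : nat.

Let T : set ((n + m).-tuple G * (m + n).-tuple G) :=
  ((trel_twist m n)^-1)%relation.

Lemma trel_twist_inv_subproof1 x y :
  T (x, y) -> forall g, T (tconj x g, tconj y g).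
Proof. by move=> /trel_conj. Qed.

Lemma trel_twist_inv_subproof2 x y : T (x, y) -> center (tprod x / tprod y).
Proof.
move=> /trel_center /= c g; apply/commute_sym.
by rewrite -[_ / _]invgK invgF; apply/commuteV/commute_sym.
Qed.

Definition trel_twist_inv : trel (n + m) (m + n) :=
  TRelArrow trel_twist_inv_subproof1 trel_twist_inv_subproof2.
End TwistInv.

Lemma trel_twist_invE m n x y :
  trel_twist_inv m n (x, y) <-> trel_twist m n (y, x).
Proof. by []. Qed.

Lemma trel_twist_isom m n : exists s : trel (n + m) (m + n),
  trel_comp s (trel_twist m n) = trel_id (m + n) /\
  trel_comp (trel_twist m n) s = trel_id (n + m).
Proof.
have canr k (t : k.-tuple G) g : tconj (tconj t g) g^-1 = t.
  by rewrite tconjM mulgV tconj1.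
have canl k (t : k.-tuple G) g : tconj (tconj t g^-1) g = t.
  by rewrite tconjM mulVg tconj1.
exists (trel_twist_inv m n); split; apply: trelP => x y;
  rewrite trel_idE trel_compE.
  have [u [v ->]] := cat_tuple_split x; have [u' [v' ->]] := cat_tuple_split y.
  split=> [[z /trel_twistE -> /trel_twist_invE/trel_twistE]|->].
    move=> /cat_tuple_inj[Ev Eu]; rewrite Eu in Ev *.
    by rewrite -(canl _ v (tprod u')) Ev canl.
  exists (cat_tuple (tconj v' (tprod u')^-1) u'); first exact/trel_twistE.
  exact/trel_twist_invE/trel_twistE.
split=> [[z]|->].
  have [u [v ->]] := cat_tuple_split z.
  by move=> /trel_twist_invE/trel_twistE -> /trel_twistE ->.
have [v [u ->]] := cat_tuple_split y.
exists (cat_tuple u (tconj v (tprod u))).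
  by apply/trel_twist_invE/trel_twistE; rewrite canr.
by apply/trel_twistE; rewrite canr.
Qed.

Lemma tconj_center m n p (R : trel m n) x y (z : p.-tuple G) :
  R (x, y) -> tconj z (tprod x)^-1 = tconj z (tprod y)^-1.
Proof.
move=> /trel_center c.
rewrite -(mulgVK (tprod y) (tprod x)) invgM.
have cV : center (tprod x / tprod y)^-1.
  by move=> g; apply/commute_sym/commuteV/commute_sym.
by rewrite -cV tconjC.
Qed.

Lemma trel_twist_nat m m' n n' (R : trel m m') (S : trel n n') :
  trel_comp (trel_twist m' n') (trel_tens R S) =
  trel_comp (trel_tens S R) (trel_twist m n).
Proof.
apply: trelP => x y.
have [u [v ->]] := cat_tuple_split x; have [v' [u' ->]] := cat_tuple_split y.
rewrite !trel_compE; split=> [[z]|[z /trel_twistE -> /trel_tensE[Sv Ru]]].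
  have [a [b ->]] := cat_tuple_split z.
  move=> /trel_tensE[Ru Sv] /trel_twistE /cat_tuple_inj[-> ->].
  exists (cat_tuple (tconj v (tprod u)^-1) u); first exact/trel_twistE.
  apply/trel_tensE; split=> //; rewrite -(tconj_center _ Ru).
  exact: trel_conj.
exists (cat_tuple u' (tconj v' (tprod u'))).
  apply/trel_tensE; split=> //.
  have := trel_conj Sv (tprod u'); rewrite (tconj_center _ Ru).
  by rewrite tconjM mulVg tconj1.
by apply/trel_twistE; rewrite tconjM mulgV tconj1.
Qed.

Lemma trel_comp_eqml m n p (E : n = p) (R : trel m n) x y :
  (trel_comp (teqm E) R) (x, y) <->
  R (x, tcast (esym E) y).
Proof. by case: _ / E y => y; rewrite (trel_comp1m R : trel_comp (teqm erefl) R = R). Qed.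

Lemma trel_comp_eqmr m n p (E : m = n) (R : trel n p) x y :
  (trel_comp R (teqm E)) (x, y) <-> R (tcast E x, y).
Proof. by case: _ / E R => R; rewrite (trel_compm1 R : trel_comp R (teqm erefl) = R). Qed.

Lemma trel_twist_tensl m n p :
  trel_twist (m + n) p =
  trel_comp (trel_comp (trel_comp (trel_comp
    (teqm (esym (addnA p m n)))
    (trel_tens (trel_twist m p) (trel_id n)))
    (teqm (esym (esym (addnA m p n)))))
    (trel_tens (trel_id m) (trel_twist n p)))
    (teqm (esym (addnA m n p))).
Proof.
apply: trelP => w t.
have [uv [z ->]] := cat_tuple_split w; have [u [v ->]] := cat_tuple_split uv.
rewrite trel_twistE trel_comp_eqmr tcast_catA.
have J : tconj z (tprod (cat_tuple u v))^-1 =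
    tconj (tconj z (tprod v)^-1) (tprod u)^-1.
  by rewrite tprod_cat invgM tconjM.
rewrite trel_compE; split=> [->|].
  exists (cat_tuple u (cat_tuple (tconj z (tprod v)^-1) v)).
    by apply/trel_tensE; split=> //; apply/trel_twistE.
  rewrite trel_comp_eqmr tcast_catAV trel_comp_eqml tcast_catAV J.
  by apply/trel_tensE; split=> //; apply/trel_twistE.
case=> s; have [u' [s' ->]] := cat_tuple_split s.
move=> /trel_tensE[/trel_idE <- /trel_twistE ->].
rewrite trel_comp_eqmr tcast_catAV trel_comp_eqml => H; rewrite J.
rewrite -[t](tcastKV (esym (addnA p m n))).
have [tu [tv Et]] := cat_tuple_split (tcast (esym (esym (addnA p m n))) t).
move: H; rewrite Et => /trel_tensE[/trel_twistE -> /trel_idE <-].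
by rewrite tcast_catA.
Qed.

Lemma trel_twist_tensr m n p :
  trel_twist m (n + p) =
  trel_comp (trel_comp (trel_comp (trel_comp
    (teqm (esym (esym (addnA n p m))))
    (trel_tens (trel_id n) (trel_twist m p)))
    (teqm (esym (addnA n m p))))
    (trel_tens (trel_twist m n) (trel_id p)))
    (teqm (esym (esym (addnA m n p)))).
Proof.
apply: trelP => w t.
have [u [vz ->]] := cat_tuple_split w; have [v [z ->]] := cat_tuple_split vz.
rewrite trel_twistE trel_comp_eqmr tcast_catAV tconj_cat.
rewrite trel_compE; split=> [->|].
  exists (cat_tuple (cat_tuple (tconj v (tprod u)^-1) u) z).
    by apply/trel_tensE; split=> //; apply/trel_twistE.
  rewrite trel_comp_eqmr tcast_catA trel_comp_eqml tcast_catA.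
  by apply/trel_tensE; split=> //; apply/trel_twistE.
case=> s; have [s' [z' ->]] := cat_tuple_split s.
move=> /trel_tensE[/trel_twistE -> /trel_idE <-].
rewrite trel_comp_eqmr tcast_catA trel_comp_eqml => H.
rewrite -[t](tcastKV (esym (esym (addnA n p m)))).
have [tu [tv Et]] :=
  cat_tuple_split (tcast (esym (esym (esym (addnA n p m)))) t).
move: H; rewrite Et => /trel_tensE[/trel_idE <- /trel_twistE ->].
by rewrite tcast_catAV.
Qed.

Definition TRel : braided :=
  @Braided TRel_monoidal trel_twist trel_twist_isom trel_twist_nat
    trel_twist_tensl trel_twist_tensr.

Definition mul_rel : set (2.-tuple G * 1.-tuple G) :=
  [set r | exists x y, r = ([tuple x; y], [tuple x * y])].

Definition one_rel : set (0.-tuple G * 1.-tuple G) :=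
  [set ([tuple], [tuple 1])].

End TRel.

Arguments mul_rel : clear implicits.
Arguments one_rel : clear implicits.

(* Main.v *)
Require Import Defs.
From HB Require Import structures.
From mathcomp Require Import all_boot.
From mathcomp Require Import boolp classical_sets.

(** The monoid laws and the left Frobenius identity are checked on elements.
    Taking opposite relations is an involution reversing composition and
    preserving tensors and identities, so the comonoid laws and the right
    Frobenius identity are the opposites of the former. Commutativity is
    x y x^-1 x = x y, and cocommutativity is the same computation backwards. *)

Set Implicit Arguments.
Unset Strict Implicit.
Unset Printing Implicit Defensive.

(** * Opposite relations, and composition with relations single-valued at a point *)

Section Opposite.
Variable G : groupType.

Local Open Scope classical_set_scope.
Local Open Scope group_scope.

Section Op.
Variables (m n : nat) (R : trel G m n).

Let Rop : set (n.-tuple G * m.-tuple G) := ((trel_set R)^-1)%relation.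

Lemma trel_op_subproof1 x y :
  Rop (x, y) -> forall g, Rop (tconj x g, tconj y g).
Proof. by move=> /trel_conj. Qed.

(** Reversing a pair inverts the quotient of the two products, and inverses of central elements are
    central. *)
Lemma trel_op_subproof2 x y : Rop (x, y) -> center (tprod x / tprod y).
Proof.
move=> /trel_center /= c g; apply/commute_sym.
by rewrite -[_ / _]invgK invgF; apply/commuteV/commute_sym.
Qed.

Definition trel_op : trel G n m :=
  TRelArrow trel_op_subproof1 trel_op_subproof2.
End Op.

Lemma trel_opE m n (R : trel G m n) x y : trel_op R (x, y) <-> R (y, x).
Proof. by []. Qed.

Lemma trel_opK m n (R : trel G m n) : trel_op (trel_op R) = R.
Proof. exact: trelP. Qed.

Lemma trel_op_id m : trel_op (trel_id G m) = trel_id G m.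
Proof. by apply: trelP => x y; split=> /esym. Qed.

Lemma trel_op_comp m n p (S : trel G n p) (R : trel G m n) :
  trel_op (trel_comp S R) = trel_comp (trel_op R) (trel_op S).
Proof. by apply: trelP => x y; split=> -[z ? ?]; exists z. Qed.

Lemma trel_op_tens m m' n n' (R : trel G m m') (S : trel G n n') :
  trel_op (trel_tens R S) = trel_tens (trel_op R) (trel_op S).
Proof.
apply: trelP => x y.
have [u [v ->]] := cat_tuple_split x; have [u' [v' ->]] := cat_tuple_split y.
by rewrite trel_opE !trel_tensE.
Qed.

Lemma trel_op_eqm m n (E : m = n) : trel_op (teqm G E) = teqm G (esym E).
Proof. by apply: trelP => x y; rewrite trel_opE !trel_eqmE; split=> ->. Qed.

(** Taking opposites turns an identification into its inverse on the other side of an equation; this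
    cancels it. *)
Lemma trel_eqmKV m n (E : m = n) :
  trel_comp (teqm G E) (teqm G (esym E)) = trel_id G n.
Proof. by case: _ / E; rewrite /teqm /eqm /= trel_comp1m. Qed.

(** Where the first relation is single-valued at [x], the existential in the composite collapses to
    evaluation at [z]. Nothing is asked of [R] at other points. *)
Lemma trel_comp_fun m n p (S : trel G n p) (R : trel G m n) x z y :
  (forall t, R (x, t) <-> t = z) -> trel_comp S R (x, y) <-> S (z, y).
Proof.
move=> Rx; rewrite trel_compE; split=> [[t /Rx ->]//|Szy].
by exists z => //; apply/Rx.
Qed.

(** Single-valuedness at a point passes to tensors, which supplies the hypothesis of
    [trel_comp_fun]. *)
Lemma trel_tens_fun m m' n n' (R : trel G m m') (S : trel G n n') x u y v :
    (forall t, R (x, t) <-> t = u) -> (forall t, S (y, t) <-> t = v) ->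
  forall t, trel_tens R S (cat_tuple x y, t) <-> t = cat_tuple u v.
Proof.
move=> Rx Sy t; have [a [b ->]] := cat_tuple_split t.
by rewrite trel_tensE Rx Sy; split=> [[-> ->]//|/cat_tuple_inj].
Qed.

Lemma trel_id_fun m (x : m.-tuple G) t : trel_id G m (x, t) <-> t = x.
Proof. by rewrite trel_idE; split=> ->. Qed.

End Opposite.

(** * Multiplication and unit of the group as arrows, and their laws *)

Section Frobenius.
Variable G : groupType.
Implicit Types a b c d : G.

Local Open Scope classical_set_scope.
Local Open Scope group_scope.

Lemma tuple1_ex (x : 1.-tuple G) : exists a, x = [tuple a].
Proof. by case/tupleP: x => a x; exists a; rewrite (tuple0 x); apply: val_inj. Qed.

Lemma tuple1_inj a b : [tuple a] = [tuple b] -> a = b.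
Proof. by case/(congr1 val). Qed.

Lemma pair_tuple_ex (x : (1 + 1).-tuple G) :
  exists a b, x = cat_tuple [tuple a] [tuple b].
Proof.
have [u [v ->]] := cat_tuple_split x.
by have [a ->] := tuple1_ex u; have [b ->] := tuple1_ex v; exists a, b.
Qed.

Lemma tprod1 a : tprod [tuple a] = a.
Proof. by rewrite /tprod big_seq1. Qed.

Lemma tconj_seq1 a g : tconj [tuple a] g = [tuple a ^ g].
Proof. exact: val_inj. Qed.

(** The pair is written as a concatenation, the form in which tensors produce it; its underlying
    sequence is that of [[tuple a; b]]. *)
Lemma mul_relE a b t :
  mul_rel G (cat_tuple [tuple a] [tuple b], t) <-> t = [tuple a * b].
Proof.
split=> [[x [y [E E' ->]]]|->]; first by rewrite E E'.
by exists a, b; congr (_, _); apply: val_inj.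
Qed.

Lemma mul_rel_conj (x : (1 + 1).-tuple G) y :
  mul_rel G (x, y) -> forall g, mul_rel G (tconj x g, tconj y g).
Proof.
have [a [b ->]] := pair_tuple_ex x => /mul_relE -> g.
by rewrite tconj_cat !tconj_seq1 conjMg; apply/mul_relE.
Qed.

Lemma mul_rel_center (x : (1 + 1).-tuple G) y :
  mul_rel G (x, y) -> center (tprod x / tprod y).
Proof.
have [a [b ->]] := pair_tuple_ex x => /mul_relE ->.
by rewrite tprod_cat !tprod1 mulgV; apply: center1.
Qed.

(** The source is [1 + 1], the tensor square of the object [1]; it is convertible with the [2] of
    [mul_rel]. *)
Definition trel_mul : trel G (1 + 1) 1 := TRelArrow mul_rel_conj mul_rel_center.

Lemma one_rel_conj x y :
  one_rel G (x, y) -> forall g, one_rel G (tconj x g, tconj y g).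
Proof.
case=> -> -> g; rewrite tconj_seq1 conj1g.
by congr (_, _); apply: val_inj.
Qed.

Lemma one_rel_center x y : one_rel G (x, y) -> center (tprod x / tprod y).
Proof.
by case=> -> ->; rewrite tprod1 /tprod big_nil mulgV; apply: center1.
Qed.

Definition trel_one : trel G 0 1 := TRelArrow one_rel_conj one_rel_center.

Lemma trel_mulE a b t :
  trel_mul (cat_tuple [tuple a] [tuple b], t) <-> t = [tuple a * b].
Proof. exact: mul_relE. Qed.

Lemma trel_oneE x t : trel_one (x, t) <-> t = [tuple 1].
Proof. by rewrite (tuple0 x); split=> [[]|->]//; congr (_, _); apply: val_inj. Qed.

Lemma trel_mulA :
  trel_comp trel_mul (trel_tens trel_mul (trel_id G 1%N)) =
  trel_comp (trel_comp trel_mul (trel_tens (trel_id G 1%N) trel_mul))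
    (teqm G (esym (addnA 1%N 1%N 1%N))).
Proof.
apply: trelP => x y; have [u [w ->]] := cat_tuple_split x.
have [a [b ->]] := pair_tuple_ex u; have [c ->] := tuple1_ex w.
rewrite trel_comp_eqmr tcast_catA.
(* Both tensors are single-valued here, so the two sides evaluate to (a b) c and a (b c). *)
rewrite (trel_comp_fun _ _ (trel_tens_fun (trel_mulE a b) (trel_id_fun _))).
rewrite (trel_comp_fun _ _ (trel_tens_fun (trel_id_fun _) (trel_mulE b c))).
by rewrite !trel_mulE mulgA.
Qed.

Lemma trel_mul1g :
  trel_comp trel_mul (trel_tens trel_one (trel_id G 1%N)) = teqm G (add0n 1%N).
Proof.
apply: trelP => x y; have [u [w ->]] := cat_tuple_split x.
have [a ->] := tuple1_ex w.
rewrite (trel_comp_fun _ _ (trel_tens_fun (trel_oneE u) (trel_id_fun _))).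
rewrite trel_mulE mul1g trel_eqmE (tuple0 u).
by split=> [->//|E]; apply/val_inj/esym.
Qed.

Lemma trel_mulg1 :
  trel_comp trel_mul (trel_tens (trel_id G 1%N) trel_one) = teqm G (addn0 1%N).
Proof.
apply: trelP => x y; have [w [u ->]] := cat_tuple_split x.
have [a ->] := tuple1_ex w.
rewrite (trel_comp_fun _ _ (trel_tens_fun (trel_id_fun _) (trel_oneE u))).
rewrite trel_mulE mulg1 trel_eqmE (tuple0 u).
by split=> [->//|E]; apply/val_inj/esym.
Qed.

(* Both sides relate (a, b) to (c, d) exactly when a b = c d: on the left
   a is split as c (c^-1 a), and d = (c^-1 a) b. *)
Lemma trel_mul_frobenius :
  trel_comp (trel_comp (trel_tens (trel_id G 1%N) trel_mul)
      (teqm G (esym (addnA 1%N 1%N 1%N))))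
    (trel_tens (trel_op trel_mul) (trel_id G 1%N)) =
  trel_comp (trel_op trel_mul) trel_mul.
Proof.
apply: trelP => x y.
have [a [b ->]] := pair_tuple_ex x; have [c [d ->]] := pair_tuple_ex y.
rewrite (trel_comp_fun _ _ (trel_mulE a b)) trel_opE trel_mulE.
rewrite trel_compE; split=> [[z]|/tuple1_inj E].
  have [u [w ->]] := cat_tuple_split z; have [p [q ->]] := pair_tuple_ex u.
  move=> /trel_tensE[/trel_opE/trel_mulE/tuple1_inj -> /trel_idE <-].
  rewrite trel_comp_eqmr tcast_catA.
  move=> /trel_tensE[/trel_idE/tuple1_inj <- /trel_mulE/tuple1_inj ->].
  by rewrite mulgA.
exists (cat_tuple (cat_tuple [tuple c] [tuple c^-1 * a]) [tuple b]).
  apply/trel_tensE; split=> //; apply/trel_opE/trel_mulE.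
  by rewrite mulVKg.
rewrite trel_comp_eqmr tcast_catA; apply/trel_tensE; split=> //.
by apply/trel_mulE; rewrite -mulgA E mulKg.
Qed.

Lemma trel_mul_twist : trel_comp trel_mul (trel_twist G 1%N 1%N) = trel_mul.
Proof.
apply: trelP => x y; have [a [b ->]] := pair_tuple_ex x.
rewrite (trel_comp_fun _ _ (trel_twistE _ _)) tprod1 tconj_seq1 !trel_mulE.
by rewrite conjgE invgK mulgA mulgVK.
Qed.

Lemma trel_twist_comul :
  trel_comp (trel_twist G 1%N 1%N) (trel_op trel_mul) = trel_op trel_mul.
Proof.
apply: trelP => x y; have [c [d ->]] := pair_tuple_ex y.
rewrite trel_compE trel_opE trel_mulE; split=> [[z]|->].
  have [a [b ->]] := pair_tuple_ex z => /trel_opE/trel_mulE ->.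
  move=> /trel_twistE; rewrite tprod1 tconj_seq1.
  move=> /cat_tuple_inj[/tuple1_inj -> /tuple1_inj ->].
  by rewrite conjgE invgK mulgA mulgVK.
(* The twist sends (a, b) to (a b a^-1, a), so the preimage of (c, d) is (d, d^-1 c d), whose
   product is again c d. *)
exists (cat_tuple [tuple d] [tuple c ^ d]).
  by apply/trel_opE/trel_mulE; rewrite conjgE mulVKg.
by apply/trel_twistE; rewrite tprod1 tconj_seq1 conjgK.
Qed.

End Frobenius.

Theorem mainTheorem6 (G : groupType) :
  exists (nabla : trel G (1 + 1) 1) (Delta : trel G 1 (1 + 1))
         (n : trel G 0 1) (e : trel G 1 0),
    [/\ trel_set nabla = mul_rel G,
        trel_set Delta = ((mul_rel G)^-1)%relation,
        trel_set n = one_rel G,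
        trel_set e = ((one_rel G)^-1)%relation &
        @is_commutative_frobenius (TRel G) 1 nabla Delta n e].
Proof.
exists (trel_mul G), (trel_op (trel_mul G)), (trel_one G), (trel_op (trel_one G)).
split=> //; split.
- by split; [exact: trel_mulA|exact: trel_mul1g|exact: trel_mulg1].
- split.
  + have := congr1 (@trel_op _ _ _) (trel_mulA G).
    rewrite !trel_op_comp !trel_op_tens trel_op_eqm trel_op_id => E.
    (* The opposite of associativity carries the inverse reassociation on its right-hand side;
       composing with the reassociation moves it to the left. *)
    have := congr1 (trel_comp (teqm G (esym (addnA 1 1 1)))) E.
    by rewrite !trel_compA trel_eqmKV trel_comp1m.
  + have := congr1 (@trel_op _ _ _) (trel_mul1g G).
    rewrite !trel_op_comp !trel_op_tens trel_op_eqm trel_op_id => E.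
    (* The opposite unit law equates a composite with an inverse identification; composing with the
       identification leaves the identity. *)
    have := congr1 (trel_comp (teqm G (add0n 1))) E.
    by rewrite trel_compA trel_eqmKV.
  + have := congr1 (@trel_op _ _ _) (trel_mulg1 G).
    rewrite !trel_op_comp !trel_op_tens trel_op_eqm trel_op_id => E.
    have := congr1 (trel_comp (teqm G (addn0 1))) E.
    by rewrite trel_compA trel_eqmKV.
- exact: trel_mul_frobenius.
(* The composite of multiplication followed by its opposite is its own opposite, so reversing the
   left identity yields the right one up to bracketing. *)
- have := congr1 (@trel_op _ _ _) (trel_mul_frobenius G).
  rewrite !trel_op_comp !trel_op_tens trel_op_eqm trel_op_id trel_opK.
  by rewrite trel_compA.
- exact: trel_mul_twist.
- exact: trel_twist_comul.
Qed.
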